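(* Let $\mathcal{V}$ be a vector space over a field $F$, let $G$ be a group with an effective linear right action $(v,g)\mapsto vg$ on $\mathcal{V}$, let $\overline{\overline{e}}$ be a selected basis of $\mathcal{V}$, and let $\mathcal{B}(\mathcal{V})$ be the basis manifold of $\mathcal{V}$, that is, the orbit $\{R(g)\overline{\overline{e}}:g\in G\}$ of $\overline{\overline{e}}$ under the induced action of $G$ on bases. Then the representation $g\mapsto R(g)$ of $G$ on $\mathcal{B}(\mathcal{V})$ is single transitive: for any two bases $\overline{\overline{e}}_1,\overline{\overline{e}}_2\in\mathcal{B}(\mathcal{V})$ there exists one and only one $g\in G$ such that $\overline{\overline{e}}_2=R(g)\overline{\overline{e}}_1$.
   Context: A linear right action of $G$ on $\mathcal{V}$ means: for each $g\in G$ the map $v\mapsto vg$ is an $F$-linear map $\mathcal{V}\to\mathcal{V}$, and $v(gh)=(vg)h$ and $v1=v$ for all $v\in\mathcal{V}$, $g,h\in G$, where $1$ is the unit of $G$ (so each such map is invertible). The action is effective if the only $g\in G$ with $vg=v$ for all $v\in\mathcal{V}$ is $g=1$. A basis $\overline{\overline{e}}=\langle e_i\rangle_{i\in I}$ of $\mathcal{V}$ is an indexed family (with fixed index set $I$) that is a maximal linearly independent family of vectors. The induced action on bases is $R(g)\langle e_i\rangle_{i\in I}=\langle e_i g\rangle_{i\in I}$. *)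

(* Defs.v *)
From HB Require Import structures.
From mathcomp Require Import all_boot all_order all_algebra.
From mathcomp Require Import boolp classical_sets.

Set Implicit Arguments.
Unset Strict Implicit.
Unset Printing Implicit Defensive.

Import GRing.Theory.

Local Open Scope classical_set_scope.
Local Open Scope ring_scope.

(* MathComp's actions require a finite acting group; G is arbitrary here. *)
Record right_action (G : groupType) (X : Type) := RightAction {
  ract :> X -> G -> X;
  ract1 : forall x, ract x 1%g = x;
  ractM : forall x g h, ract x (g * h)%g = ract (ract x g) h }.

Record linear_right_action (F : fieldType) (V : lmodType F) (G : groupType) :=
  LinearRightAction {
    lract :> right_action G V;
    lract_linear : forall g, linear (fun v : V => lract v g) }.

Definition effective (G : groupType) (X : Type) (rho : right_action G X) :=
  forall g : G, (forall x, rho x g = x) -> g = 1%g.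

Definition single_transitive (G : groupType) (X : Type)
    (rho : right_action G X) :=
  forall x1 x2 : X, exists! g : G, x2 = rho x1 g.

Section Orbit.
Variables (G : groupType) (X : Type) (rho : right_action G X) (x0 : X).

Definition orbit : set X := [set rho x0 g | g in [set: G]].

Lemma orbit_stable x g : x \in orbit -> rho x g \in orbit.
Proof.
move=> /set_mem[h _ <-]; apply/mem_set; exists (h * g)%g => //.
exact: ractM.
Qed.

Definition orbit_ract (x : orbit) (g : G) : orbit :=
  exist _ (rho (sval x) g) (orbit_stable g (svalP x)).

Lemma orbit_ract1 x : orbit_ract x 1%g = x.
Proof. by case: x => x xP; apply: eq_exist; rewrite ract1. Qed.

Lemma orbit_ractM x g h :
  orbit_ract x (g * h)%g = orbit_ract (orbit_ract x g) h.
Proof. by apply: eq_exist; rewrite ractM. Qed.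

Definition orbit_action : right_action G orbit :=
  RightAction orbit_ract1 orbit_ractM.

End Orbit.

Section Bases.
Variables (F : fieldType) (V : lmodType F).

(* The injection h selects finitely many pairwise distinct indices, so a family
   with a repeated vector is dependent. *)
Definition linearly_independent (J : Type) (u : J -> V) :=
  forall (n : nat) (h : 'I_n -> J) (c : 'I_n -> F), injective h ->
    \sum_(k < n) c k *: u (h k) = 0 -> forall k, c k = 0.

Definition is_basis (I : Type) (e : I -> V) :=
  linearly_independent e /\
  forall (J : Type) (u : J -> V), linearly_independent u ->
    range e `<=` range u -> range u `<=` range e.

Record basis (I : Type) := Basis {
  basis_fam :> I -> V;
  basisP : is_basis basis_fam }.

Lemma basis_eq (I : Type) (b1 b2 : basis I) :
  basis_fam b1 = basis_fam b2 -> b1 = b2.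
Proof.
by case: b1 b2 => [e1 p1] [e2 p2] /= e12; case: _ / e12 p2 => p2; congr Basis.
Qed.

Variables (G : groupType) (rho : linear_right_action V G).

Lemma lract_indep (J : Type) (u : J -> V) g :
  linearly_independent u -> linearly_independent (fun j => rho (u j) g).
Proof.
pose L := GRing.isLinear.Build _ _ _ _ _ (@lract_linear _ _ _ rho g^-1%g).
pose f : {linear V -> V} := HB.pack (fun v : V => rho v g^-1%g) L.
move=> uI n h c h_inj /(congr1 f); rewrite linear_sum linear0 => E.
apply: (uI n h c h_inj); rewrite -[RHS]E; apply: eq_bigr => k _.
by rewrite linearZ /= -ractM mulgV ract1.
Qed.

Lemma lract_basis (I : Type) (e : I -> V) g :
  is_basis e -> is_basis (fun i => rho (e i) g).
Proof.
case=> eI eM; split=> [|J u uI sub _ [j _ <-]]; first exact: lract_indep.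
have sub' : range e `<=` range (fun j => rho (u j) g^-1%g).
  move=> _ [i _ <-]; have [|k _ E] := sub (rho (e i) g); first by exists i.
  by exists k => //; rewrite E -ractM mulgV ract1.
have [|i _ E] := eM J _ (lract_indep (g := g^-1%g) uI) sub' (rho (u j) g^-1%g).
  by exists j.
by exists i => //; rewrite E -ractM mulVg ract1.
Qed.

Variable I : Type.

Definition basis_ract (b : basis I) (g : G) : basis I :=
  Basis (lract_basis g (basisP b)).

Lemma basis_ract1 b : basis_ract b 1%g = b.
Proof. by apply: basis_eq; apply/funext => i /=; rewrite ract1. Qed.

Lemma basis_ractM b g h :
  basis_ract b (g * h)%g = basis_ract (basis_ract b g) h.
Proof. by apply: basis_eq; apply/funext => i /=; rewrite ractM. Qed.

Definition basis_action : right_action G (basis I) :=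
  RightAction basis_ract1 basis_ractM.

Definition basis_manifold (e : basis I) : set (basis I) :=
  orbit basis_action e.

Definition basis_manifold_action (e : basis I) :
    right_action G (basis_manifold e) :=
  orbit_action basis_action e.

End Bases.

(* Main.v *)
Require Import Defs.
From HB Require Import structures.
From mathcomp Require Import all_boot all_order all_algebra.
From mathcomp Require Import boolp classical_sets.

(** Transitivity is formal: [e h] and [e k] are exchanged by [h^-1 k]. For
    uniqueness, linear maps that agree on a basis are equal, so if [b g = b h]
    for a basis [b], then [g h^-1] acts trivially and [g = h] by effectiveness.
    A basis being a maximal independent family, the agreement on [V] is obtained
    without passing through spans: a vector outside the kernel of a linear map
    killing [b] could be added to [b] without losing independence. *)

Import GRing.Theory.
Local Open Scope classical_set_scope.
Local Open Scope ring_scope.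

Section LinearMapsOnBases.
Variables (F : fieldType) (V U : lmodType F) (I : Type) (e : I -> V).

(** Applying [d] to a vanishing combination kills every term except that of [v], so the coefficient
    of [v] is zero; what remains is a combination of [e] alone. *)
Lemma linearly_independent_some (d : {linear V -> U}) (v : V) :
    linearly_independent e -> (forall i, d (e i) = 0) -> d v <> 0 ->
  linearly_independent (fun o : option I => if o is Some i then e i else v).
Proof.
move=> e_indep de0 dv0 n h c h_inj sum0.
(* [h'] selects terms indexed away from [None]: all of them if [None] is not hit, otherwise those
   other than [k0]. *)
have indep_some m (h' : 'I_m -> 'I_n) : injective h' ->
    (forall k, h (h' k) <> None) ->
    \sum_(k < m) c (h' k) *: (if h (h' k) is Some i then e i else v) = 0 ->
    forall k, c (h' k) = 0.
  move=> h'_inj h_some s0.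
  have [p hp] : {p : 'I_m -> I & forall k, h (h' k) = Some (p k)}.
    apply: (@choice _ _ (fun k i => h (h' k) = Some i)) => k.
    by case E: (h (h' k)) (h_some k) => [i|] // _; exists i.
  apply: (e_indep m p (c \o h')) => [k l pkl|].
    by apply/h'_inj/h_inj; rewrite !hp pkl.
  by rewrite -[RHS]s0; apply: eq_bigr => k _; rewrite hp.
have [[k0 hk0]|h_some] := pselect (exists k, h k = None); last first.
  by apply: (indep_some n id) => // k hk; apply: h_some; exists k.
have ck0 : c k0 = 0.
  move/(congr1 d): sum0; rewrite linear0 linear_sum (bigD1 k0) //= big1 => [|k].
    by rewrite addr0 hk0 linearZ => /eqP; rewrite scaler_eq0 => /orP[]/eqP.
  move=> /eqP k_k0; case E: (h k) => [i|]; first by rewrite linearZ /= de0 scaler0.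
  by case: k_k0; apply: h_inj; rewrite E.
(* [lift k0] will enumerate the indices other than [k0], which needs [n] to be a successor. *)
case: n k0 h c h_inj sum0 indep_some hk0 ck0 => [[] //|n] k0 h c h_inj sum0.
move=> indep_some hk0 ck0 k.
have [j ->|-> //] := unliftP k0 k.
apply: (indep_some n (lift k0)) => [|i hi|]; first exact: lift_inj.
  by have /eqP := neq_lift k0 i; apply; apply: h_inj; rewrite hi.
by move: sum0; rewrite (bigD1_ord k0) //= ck0 scale0r add0r.
Qed.

Lemma linear_eq_on_basis (f g : {linear V -> U}) :
  is_basis e -> (forall i, f (e i) = g (e i)) -> f =1 g.
Proof.
case=> e_indep e_max fg v; apply: contrapT => fgv.
have sub0 w : (f \- g) w = 0 <-> f w = g w.
  by split=> [/eqP|fgw]; rewrite /= ?fgw ?subrr // subr_eq0 => /eqP.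
have ext_indep : linearly_independent
    (fun o : option I => if o is Some i then e i else v).
  apply: (linearly_independent_some (f \- g)) => // [i|].
    by apply/sub0.
  by move/sub0.
(* Maximality forces [v] into the range of [e], where [f] and [g] agree. *)
have [||i _ ev] := e_max _ _ ext_indep _ v.
- by move=> _ [i _ <-]; exists (Some i).
- by exists None.
by apply: fgv; rewrite -ev.
Qed.

End LinearMapsOnBases.

Lemma basis_action_free (F : fieldType) (V : lmodType F) (G : groupType)
    (rho : linear_right_action V G) (I : Type) (b : basis V I) (g h : G) :
  effective rho -> basis_action rho I b g = basis_action rho I b h -> g = h.
Proof.
move=> rho_eff /(congr1 (@basis_fam _ _ _)) /= bgh.
have lin k : GRing.isLinear F V V *:%R (fun v => rho v k).
  exact: (GRing.isLinear.Build _ _ _ _ _ (lract_linear rho k)).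
pose f k : {linear V -> V} := HB.pack (fun v => rho v k) (lin k).
have fE : f g =1 f h.
  by apply: linear_eq_on_basis (basisP b) _ => i; exact: (congr1 (@^~ i) bgh).
apply/divg1_eq; apply: rho_eff => v.
by rewrite ractM [rho v g]fE -ractM mulgV ract1.
Qed.

Theorem theorem5p2 (F : fieldType) (V : lmodType F) (G : groupType)
    (rho : linear_right_action V G) (rho_eff : effective rho)
    (I : Type) (e : basis V I) :
  single_transitive (basis_manifold_action rho e).
Proof.
move=> x1 x2.
have /set_mem[g1 _ E1] := svalP x1; have /set_mem[g2 _ E2] := svalP x2.
have x12 : sval x2 = basis_action rho I (sval x1) (g1^-1 * g2)%g.
  by rewrite -E1 -E2 -ractM mulVKg.
exists (g1^-1 * g2)%g; split=> [|h /(congr1 sval) x2h].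
  (* Points of the orbit are bases paired with membership proofs; by proof irrelevance, equality of
     the bases suffices. *)
  by case: x1 x2 x12 {E1 E2} => [b1 p1] [b2 p2] E; apply: eq_exist.
by apply: (basis_action_free _ _ _ rho I (sval x1)) => //; rewrite -x12.
Qed.
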